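(* Let $k$ and $\tilde k$ be odd positive integers, and let $P\in\Sigma_{n,d}(k)$ and $\tilde P\in\Sigma_{n,d}(\tilde k)$. Then $P+\tilde P\in\Sigma_{n,d}(k+\tilde k-1)$. In particular, $\Sigma_{n,d}(\infty)$ is a convex cone.
   Context: $P_{n,d}$ is the cone of real forms of degree $d$ in $n$ variables that are nonnegative on $\mathbb{R}^n$; $\Sigma_{n,d}\subset P_{n,d}$ is the cone of forms that are sums of squares of real forms of degree $d/2$. For odd $k\ge 1$, $\Sigma_{n,d}(k)=\{P\in P_{n,d}: P^{k}\in\Sigma_{n,kd}\}$, and $\Sigma_{n,d}(\infty)=\bigcup_{k\ge 1\text{ odd}}\Sigma_{n,d}(k)$. *)

(* Defs.v *)
From mathcomp Require Import all_boot all_order all_algebra.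
From mathcomp Require Import mpoly.
From mathcomp Require Import classical_sets reals.
(* Not imported: the notations of the analysis files clash with those of mpoly. *)
From mathcomp Require convex.

Set Implicit Arguments.
Unset Strict Implicit.
Unset Printing Implicit Defensive.

Import Order.TTheory GRing.Theory Num.Theory.
Local Open Scope classical_set_scope.
Local Open Scope ring_scope.

(* P_{n,d}; the zero polynomial is d-homogeneous for every d. *)
Definition psd_forms (R : realType) (n d : nat) : set {mpoly R[n]} :=
  [set p | p \is d.-homog /\ forall v : 'I_n -> R, 0 <= p.@[v]].

(* Sigma_{n,d}; the equation e.*2 = d expresses that e is d / 2 without
   truncation, so that for odd d only the empty sum, 0, is allowed (and
   P_{n,d} = {0} as well). *)
Definition sos_forms (R : realType) (n d : nat) : set {mpoly R[n]} :=
  [set p | exists2 s : seq {mpoly R[n]},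
     (forall q, q \in s -> exists2 e : nat, e.*2 = d & q \is e.-homog)
     & p = \sum_(q <- s) q ^+ 2].

(* Sigma_{n,d}(k), meant for odd k. *)
Definition sos_power (R : realType) (n d k : nat) : set {mpoly R[n]} :=
  [set p | psd_forms d p /\ sos_forms (k * d) (p ^+ k)].

(* Sigma_{n,d}(oo) *)
Definition sos_power_inf (R : realType) (n d : nat) : set {mpoly R[n]} :=
  \bigcup_(k in [set k : nat | odd k]) @sos_power R n d k.

Definition cone (R : realType) (V : lmodType R) (A : set V) : Prop :=
  A !=set0 /\ forall (a : R) (x : V), 0 <= a -> A x -> A (a *: x).

Definition convex_cone (R : realType) (V : lmodType R) (A : set V) : Prop :=
  cone A /\ convex.convex_set (A : set (convex.convex_lmodType V)).

(* Main.v *)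
Require Import Defs.
From mathcomp Require Import all_boot all_order all_algebra.
From mathcomp Require Import mpoly.
From mathcomp Require Import classical_sets reals.
From mathcomp Require Import ring lra polyrcf.
From mathcomp Require interval_inference subspace_topology derive.

Set Implicit Arguments.
Unset Strict Implicit.
Unset Printing Implicit Defensive.

Import Order.TTheory GRing.Theory Num.Theory.
Local Open Scope ring_scope.

(** Write k = a + 1 and k' = b + 1, with a and b even, and s = p + p'. The
    binomial expansion of s ^ (a + b + 1) splits into the terms divisible by
    p ^ (a + 1) and those divisible by p' ^ (b + 1):
      s ^ (a + b + 1) = p ^ (a + 1) * F_(a,b) (s, p')
                        + p' ^ (b + 1) * F_(b,a) (s, p),
    and, once rewritten in terms of s, the cofactor has the simple form
      F_(a,b) (s, y) = sum_(j <= b) C(a + j, a) s ^ (b - j) y ^ j,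
    the homogenization of the degree b truncation f of the power series
    (1 - X) ^ - (a + 1) (lemma [exprD_negbin]). Since p ^ (a + 1) and
    p' ^ (b + 1) are sums of squares of forms by hypothesis, it is enough that
    F_(a,b), evaluated at two forms of degree d, is one as well.

    The univariate f is nonnegative ([negbin_poly_ge0]). It satisfies
    (1 - X) f' = (a + 1) f - c X ^ b with c > 0, because the full series solves
    the equation without the last term; at a global minimum x0 of f, which
    exists because b is even, f' vanishes, so (a + 1) f(x0) = c x0 ^ b >= 0.

    Finally a nonnegative univariate polynomial f is a sum of squares, and this
    survives homogenization and substitution of forms ([sos_homogenize]): if x0
    is a global minimum then f = f(x0) + (X - x0) ^ 2 q with q nonnegative of
    smaller degree ([poly_min_factor]), so that induction on the degree
    applies.

    Convexity of the union over all odd exponents follows, because each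
    exponent gives a set stable under nonnegative scaling and k + k' - 1 is odd
    again. *)

(** * Global minima of real univariate polynomials *)

(** By continuity. It gives the sign at the one point x0 where comparing p with
    (X - x0) g says nothing about g. *)
Lemma poly_ge0_adherent (R : rcfType) (p : {poly R}) (x : R) :
  (forall d, 0 < d -> exists2 y, `|y - x| < d & 0 <= p.[y]) -> 0 <= p.[x].
Proof.
move=> near_ge0; rewrite leNgt; apply/negP => px_lt0.
have [|d d_gt0 pd] := @poly_cont _ x p (- p.[x]); first by rewrite oppr_gt0.
have [y /pd + py_ge0] := near_ge0 d d_gt0.
by rewrite ltr_norml => /andP[_]; lra.
Qed.

Section PolyMinimum.
Import normed_module.numFieldNormedType.Exports.

(** Outside the Cauchy bound of p - p(0) this polynomial has the sign of its
    leading term, hence p >= p(0) there; so the minimum of p on the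
    corresponding segment is global. *)
Lemma poly_attains_min (R : realType) (p : {poly R}) :
  odd (size p) -> 0 < lead_coef p -> exists x0, forall x, p.[x0] <= p.[x].
Proof.
move=> size_odd lead_gt0.
have [sz1|sz_gt1] := leqP (size p) 1.
  by exists 0 => x; rewrite (size1_polyC sz1) !hornerC.
pose q := p - p.[0]%:P; pose b := cauchy_bound q.
have szC : (size (- p.[0]%:P) < size p)%N.
  by rewrite size_polyN (leq_ltn_trans (size_polyC_leq1 _)).
have size_q : size q = size p by rewrite size_polyDl.
have lead_q : lead_coef q = lead_coef p by rewrite lead_coefDl.
have q_neq0 : q != 0 by rewrite -lead_coef_eq0 lead_q gt_eqF.
have hq x : q.[x] = p.[x] - p.[0] by rewrite !hornerE.
have b_gt0 : 0 < b := cauchy_bound_gt0 q.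
have out (x : R) : b <= `|x| -> p.[0] <= p.[x].
  move=> b_le; suff: Num.sg q.[x] = 1.
    by move/eqP; rewrite sgr_cp0 hq subr_gt0 => /ltW.
  have [x_ge0|x_lt0] := leP 0 x.
    rewrite (sgp_pinftyP (ge_cauchy_bound q_neq0)); last first.
      by rewrite in_itv /= andbT -(ger0_norm x_ge0).
    by rewrite /sgp_pinfty lead_q gtr0_sg.
  rewrite (sgp_minftyP (le_cauchy_bound q_neq0)); last first.
    by rewrite in_itv /= lerNr -(ltr0_norm x_lt0).
  rewrite /sgp_minfty lead_q size_q -signr_odd.
  by move: size_odd; case: (size p) => //= n /negbTE->; rewrite mul1r gtr0_sg.
have [||x0 _ min_x0] := @derive.EVT_min R (horner p) (- b) b.
- by rewrite ge0_cp // ltW.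
- apply: subspace_topology.continuous_subspaceT; exact: derive.continuous_horner.
exists x0 => x; have [x_in|x_out] := leP `|x| b.
  by apply: min_x0; rewrite in_itv /= -ler_norml.
apply: le_trans (out _ (ltW x_out)); apply: min_x0.
by rewrite in_itv /= oppr_le0 ltW.
Qed.

End PolyMinimum.

(** The quotient of p - p(x0) by X - x0 changes sign at x0, from nonpositive to
    nonnegative; it therefore vanishes there, which yields the second factor
    X - x0. The cofactor q is then nonnegative away from x0, since
    (x - x0) ^ 2 q(x) = p(x) - p(x0), and at x0 by continuity. *)
Lemma poly_min_factor (R : rcfType) (p : {poly R}) (x0 : R) :
    (forall x, p.[x0] <= p.[x]) ->
  exists2 q, p = p.[x0]%:P + ('X - x0%:P) ^+ 2 * q & forall x, 0 <= q.[x].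
Proof.
move=> min_x0.
have /factor_theorem[g def_g] : root (p - p.[x0]%:P) x0.
  by rewrite rootE !hornerE subrr.
have hg x : p.[x] - p.[x0] = g.[x] * (x - x0).
  by have /(congr1 (horner^~ x)) := def_g; rewrite !hornerE.
have g_right x : x0 < x -> 0 <= g.[x].
  by move=> x_gt; rewrite -(pmulr_lge0 _ (_ : 0 < x - x0)) ?subr_gt0// -hg subr_ge0.
have g_left x : x < x0 -> g.[x] <= 0.
  by move=> x_lt; rewrite -(nmulr_lge0 _ (_ : x - x0 < 0)) ?subr_lt0// -hg subr_ge0.
have close d (d_gt0 : 0 < d) : `|x0 + d / 2 - x0| < d /\ `|x0 - d / 2 - x0| < d.
  have -> : x0 - d / 2 - x0 = - (d / 2) by ring.
  have -> : x0 + d / 2 - x0 = d / 2 by ring.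
  by rewrite normrN gtr0_norm; lra.
have /factor_theorem[q def_q] : root g x0.
  rewrite rootE eq_le; apply/andP; split; last first.
    apply: poly_ge0_adherent => d d_gt0; exists (x0 + d / 2).
      by have [] := close d d_gt0.
    by apply: g_right; lra.
  rewrite -oppr_ge0 -hornerN; apply: poly_ge0_adherent => d d_gt0.
  exists (x0 - d / 2); first by have [] := close d d_gt0.
  by rewrite hornerN oppr_ge0; apply: g_left; lra.
have def_p : p = p.[x0]%:P + ('X - x0%:P) ^+ 2 * q.
  by rewrite -[LHS](subrK p.[x0]%:P) def_g def_q; ring.
exists q => // x.
have q_ge0 y : y != x0 -> 0 <= q.[y].
  move=> y_neq; have y_gt0 : 0 < (y - x0) ^+ 2.
    by rewrite exprn_even_gt0 //= subr_eq0.
  rewrite -(pmulr_lge0 _ y_gt0).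
  have <- : p.[y] - p.[x0] = q.[y] * (y - x0) ^+ 2.
    by rewrite {1}def_p hornerD hornerC hornerM horner_exp hornerXsubC; ring.
  by rewrite subr_ge0.
have [->|/q_ge0 //] := eqVneq x x0.
apply: poly_ge0_adherent => d d_gt0; exists (x0 + d / 2).
  by have [] := close d d_gt0.
by apply: q_ge0; rewrite gt_eqF //; lra.
Qed.

(** * Truncations of the negative binomial series *)

(** The truncation in degree b of (1 - X) ^ - (a + 1). *)
Definition negbin_poly (R : nzRingType) (a b : nat) : {poly R} :=
  \poly_(j < b.+1) 'C(a + j, a)%:R.

Lemma negbin_polyS (R : nzRingType) (a b : nat) :
  negbin_poly R a b.+1 = negbin_poly R a b + 'C(a + b.+1, a)%:R *: 'X^(b.+1).
Proof. by rewrite /negbin_poly !poly_def big_ord_recr. Qed.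

Lemma negbin_lead_gt0 (R : numDomainType) (a b : nat) : 0 < 'C(a + b, a)%:R :> R.
Proof. by rewrite ltr0n bin_gt0 leq_addr. Qed.

Lemma size_negbin_poly (R : numDomainType) (a b : nat) :
  size (negbin_poly R a b) = b.+1.
Proof. by rewrite size_poly_eq ?gt_eqF ?negbin_lead_gt0. Qed.

Lemma lead_negbin_poly (R : numDomainType) (a b : nat) :
  lead_coef (negbin_poly R a b) = 'C(a + b, a)%:R.
Proof. by rewrite lead_coefE size_negbin_poly coef_poly ltnSn. Qed.

(** The series y = (1 - X) ^ - (a + 1) solves (1 - X) y' = (a + 1) y; truncation
    only adds an error term in the top degree. *)
Lemma deriv_negbin_poly (R : comNzRingType) (a b : nat) :
  (1 - 'X) * (negbin_poly R a b)^`() =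
    a.+1%:R *: negbin_poly R a b - ((a + b).+1 * 'C(a + b, a))%:R *: 'X^b.
Proof.
elim: b => [|b IHb].
  have -> : negbin_poly R a 0 = 1%:P.
    by rewrite /negbin_poly poly_def big_ord1 addn0 binn scale1r expr0.
  by rewrite derivC mulr0 addn0 binn muln1 expr0 subrr.
rewrite negbin_polyS derivD derivZ derivXn /= mulrDr IHb.
have := mul_bin_down (a + b).+1 a.
rewrite /= addnS subSn ?leq_addr // addKn => ->.
rewrite -!mul_polyC -mulr_natl !natrM !polyCM !polyC_natr exprS.
move: (negbin_poly R a b) ('C(_, _)) ('X^b) => f c Xb.
ring.
Qed.

(** At a global minimum x0 the derivative vanishes and [deriv_negbin_poly]
    expresses the value as a positive multiple of x0 ^ b. *)
Lemma negbin_poly_ge0 (R : realType) (a b : nat) (x : R) :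
  ~~ odd b -> 0 <= (negbin_poly R a b).[x].
Proof.
move=> b_even; have [|| x0 min_x0] := @poly_attains_min R (negbin_poly R a b).
- by rewrite size_negbin_poly.
- by rewrite lead_negbin_poly negbin_lead_gt0.
apply: le_trans (min_x0 x).
have [q def_q _] := poly_min_factor min_x0.
have d0 : (negbin_poly R a b)^`().[x0] = 0.
  rewrite def_q derivD derivC derivM deriv_exp derivXsubC expr1 mul1r add0r.
  by rewrite hornerD !hornerM hornerMn hornerXsubC subrr; ring.
have := congr1 (horner^~ x0) (deriv_negbin_poly R a b).
rewrite !hornerE d0 mulr0 => /esym/eqP; rewrite subr_eq0 => /eqP eq_x0.
rewrite -(pmulr_rge0 _ (ltr0Sn R a)) eq_x0 mulr_ge0 ?ler0n //.
by rewrite exprn_even_ge0.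
Qed.

(** * Homogenization of univariate polynomials *)

Section Homogenization.
Variables (R : comNzRingType) (A : comAlgType R).
Implicit Types (p q : {poly R}) (s y : A).

(** The form s ^ e * p (y / s). *)
Definition homogenize e p s y := \sum_(j < e.+1) p`_j *: (s ^+ (e - j) * y ^+ j).

Lemma homogenizeD e p q s y :
  homogenize e (p + q) s y = homogenize e p s y + homogenize e q s y.
Proof. by rewrite -big_split; apply: eq_bigr => j _; rewrite coefD scalerDl. Qed.

Lemma homogenizeC e c s y : homogenize e c%:P s y = c *: s ^+ e.
Proof.
rewrite /homogenize big_ord_recl big1 => [|j _]; last by rewrite coefC scale0r.
by rewrite coefC subn0 expr0 mulr1 addr0.
Qed.

Lemma homogenizeS e p s y :
  homogenize e.+1 p s y = s * homogenize e p s y + p`_e.+1 *: y ^+ e.+1.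
Proof.
rewrite /homogenize big_ord_recr subnn mul1r; congr (_ + _).
rewrite mulr_sumr; apply: eq_bigr => j _ /=.
by rewrite subSn ?leq_ord // exprS -scalerAr mulrA.
Qed.

Lemma homogenize_mulXsubC e q c s y : (size q <= e.+1)%N ->
  homogenize e.+1 (('X - c%:P) * q) s y = (y - c *: s) * homogenize e q s y.
Proof.
move=> size_q.
have homX : homogenize e.+1 ('X * q) s y = y * homogenize e q s y.
  rewrite /homogenize big_ord_recl coefXM scale0r add0r mulr_sumr.
  apply: eq_bigr => j _; rewrite coefXM /= /bump /= add1n subSS /= exprS.
  by rewrite -scalerAr mulrCA.
have homc : homogenize e.+1 (- c%:P * q) s y = - (c *: s) * homogenize e q s y.
  rewrite homogenizeS (nth_default _ (leq_trans _ size_q)); last first.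
    rewrite -polyCN mul_polyC; exact: size_scale_leq.
  rewrite scale0r addr0 mulr_sumr mulr_sumr; apply: eq_bigr => j _.
  rewrite -polyCN mul_polyC coefZ -scaleNr -!scalerAr -scalerAl scalerA.
  by rewrite [_ * - c]mulrC.
by rewrite mulrBl -mulNr homogenizeD homX homc -mulrDl.
Qed.

End Homogenization.

(** * Sums of squares of forms *)

Section SumsOfSquares.
Variables (R : realType) (n : nat).
Implicit Types (p q : {mpoly R[n]}).

Lemma sos_forms0 D : sos_forms D (0 : {mpoly R[n]}).
Proof. by exists [::]; rewrite ?big_nil. Qed.

Lemma sos_formsD D p q : sos_forms D p -> sos_forms D q -> sos_forms D (p + q).
Proof.
move=> [sp hp ->] [sq hq ->]; exists (sp ++ sq); last by rewrite big_cat.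
by move=> r; rewrite mem_cat => /orP[/hp|/hq].
Qed.

Lemma sos_forms_sqr e q : q \is e.-homog -> sos_forms e.*2 (q ^+ 2).
Proof.
move=> q_homog; exists [:: q]; last by rewrite big_seq1.
by move=> r /[!inE] /eqP->; exists e.
Qed.

Lemma sos_formsM D E p q :
  sos_forms D p -> sos_forms E q -> sos_forms (D + E) (p * q).
Proof.
move=> [sp hp ->] [sq hq ->].
exists [seq r * t | r <- sp, t <- sq]; last first.
  rewrite big_allpairs_dep mulr_suml; apply: eq_bigr => r _.
  by rewrite mulr_sumr; apply: eq_bigr => t _; rewrite exprMn.
move=> _ /allpairsP[[r t] [/= /hp[e eD r_homog] /hq[f fE t_homog] ->]].
by exists (e + f)%N; [rewrite doubleD eD fE | exact: dhomogM].
Qed.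

Lemma sos_formsZ D c p : 0 <= c -> sos_forms D p -> sos_forms D (c *: p).
Proof.
move=> c_ge0 sos_p; rewrite -mul_mpolyC -[D]add0n; apply: sos_formsM => //.
rewrite -(sqr_sqrtr c_ge0) rmorphXn /=; apply: (sos_forms_sqr (e := 0)).
by rewrite -alg_mpolyC; apply/dhomogZ/dhomog1.
Qed.

(** Subtracting the minimum leaves (X - x0) ^ 2 times a nonnegative polynomial of
    smaller degree, and the homogenization of (X - x0) ^ 2 q is
    (y - x0 s) ^ 2 times that of q. The hypotheses on the size and the leading
    coefficient pass to q, hence a minimum exists at every stage. *)
Lemma sos_homogenize e d (f : {poly R}) (s y : {mpoly R[n]}) :
    s \is d.-homog -> y \is d.-homog ->
    size f = e.*2.+1 -> 0 < lead_coef f -> (forall x, 0 <= f.[x]) ->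
  sos_forms (e.*2 * d) (homogenize e.*2 f s y).
Proof.
move=> s_homog y_homog; elim: e f => [|e IHe] f size_f lead_f f_ge0.
  have [c def_f] : exists c, f = c%:P.
    by exists f`_0; rewrite [LHS]size1_polyC ?size_f.
  rewrite def_f homogenizeC; apply: sos_formsZ.
    by have := f_ge0 0; rewrite def_f hornerC.
  by rewrite expr0 -(expr1n _ 2) mul0n -double0; apply/sos_forms_sqr/dhomog1.
have [|x0 min_x0] := @poly_attains_min R f _ lead_f.
  by rewrite size_f /= odd_double.
have [q def_f q_ge0] := poly_min_factor min_x0.
have q_neq0 : q != 0.
  apply: contra_eq_neq size_f => q0; rewrite def_f q0 mulr0 addr0.
  by rewrite neq_ltn (leq_ltn_trans (size_polyC_leq1 _)).
have size_Xq : size (('X - x0%:P) ^+ 2 * q) = (size q).+2.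
  by rewrite size_monicM ?monic_exp ?monicXsubC // size_exp_XsubC.
have szC : (size (f.[x0])%:P < size (('X - x0%:P) ^+ 2 * q)%R)%N.
  by rewrite size_Xq (leq_ltn_trans (size_polyC_leq1 _)).
have size_q : size q = e.*2.+1.
  by move: size_f; rewrite def_f addrC size_polyDl // size_Xq doubleS => -[].
have lead_q : 0 < lead_coef q.
  move: lead_f; rewrite def_f addrC lead_coefDl //.
  by rewrite lead_coef_monicM ?monic_exp ?monicXsubC.
rewrite def_f homogenizeD homogenizeC; apply: sos_formsD.
  apply: sos_formsZ => //; rewrite -doubleMl mulnC -[e.+1.*2]muln2 exprM.
  exact/sos_forms_sqr/dhomogMn.
rewrite expr2 -mulrA doubleS !homogenize_mulXsubC ?size_q //; last first.
  by rewrite size_monicM ?monicXsubC // size_XsubC size_q.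
rewrite mulrA -expr2 -addn2 mulnDl mul2n addnC; apply: sos_formsM.
  apply: sos_forms_sqr.
  by rewrite rpredB // dhomogZ.
exact: IHe.
Qed.

End SumsOfSquares.

(** * Splitting a binomial power *)

Section BinomialSplit.
Variables (R : comNzRingType) (A : comAlgType R).
Implicit Types (x y s : A).

(** The cofactor of x ^ a.+1 in the split of (x + y) ^ (a + b).+1, where
    s = x + y. *)
Definition negbin_form a b s y : A := homogenize b (negbin_poly R a b) s y.

Lemma negbin_form0 a s y : negbin_form a 0 s y = 1.
Proof.
by rewrite /negbin_form/homogenize big_ord1 coef_poly addn0 binn scale1r mulr1.
Qed.

Lemma negbin_formS a b s y :
  negbin_form a b.+1 s y =
    s * negbin_form a b s y + 'C(a + b.+1, a)%:R * y ^+ b.+1.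
Proof.
rewrite /negbin_form homogenizeS coef_poly ltnSn scaler_nat mulr_natl.
congr (_ * _ + _); apply: eq_bigr => j _.
by rewrite !coef_poly ltnS (ltnW (ltn_ord j)) ltn_ord.
Qed.

(** For s = x + y this reads y F_(b+1,a) = s F_(b,a) - C(a+b+1, a) x ^ (a+1): it
    says how the second summand of [exprD_negbin] changes when b increases, and
    its last term cancels the one that [negbin_formS] adds to the first. *)
Lemma negbin_form_mulB a b x s :
  (s - x) * negbin_form b.+1 a s x =
    s * negbin_form b a s x - 'C(a + b.+1, a)%:R * x ^+ a.+1.
Proof.
elim: a => [|a IHa]; first by rewrite !negbin_form0 bin0 expr1; ring.
rewrite !negbin_formS mulrDr mulrCA IHa.
have binC m k : 'C(m + k, m) = 'C(k + m, k).
  by rewrite -bin_sub ?leq_addr // addKn addnC.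
have pascal : 'C(b.+1 + a.+1, b.+1) = ('C(a + b.+1, a) + 'C(b + a.+1, b))%N.
  by rewrite addSn binS -addSnnS binC.
rewrite (binC a.+1) pascal.
rewrite (exprS x a.+1) natrD; ring.
Qed.

(** A monomial of degree a + b + 1 in x and y is divisible by exactly one of
    x ^ a.+1 and y ^ b.+1; the two summands sort the binomial expansion
    accordingly. The induction on b uses only the recursions above. *)
Lemma exprD_negbin a b x y :
  (x + y) ^+ (a + b).+1 =
    x ^+ a.+1 * negbin_form a b (x + y) y + y ^+ b.+1 * negbin_form b a (x + y) x.
Proof.
elim: b => [|b IHb].
  rewrite negbin_form0 mulr1 addn0 expr1; elim: a => [|a IHa].
    by rewrite negbin_form0 mulr1 !expr1.
  rewrite negbin_formS bin0 exprS IHa (exprS x a.+1); ring.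
rewrite addnS exprS IHb negbin_formS.
have -> : y ^+ b.+2 * negbin_form b.+1 a (x + y) x =
    y ^+ b.+1 * ((x + y - x) * negbin_form b.+1 a (x + y) x).
  by rewrite exprSr; ring.
rewrite negbin_form_mulB; ring.
Qed.

End BinomialSplit.

(** * The cones of forms with a power that is a sum of squares *)

Lemma sos_power_add (R : realType) (n d k k' : nat) (p p' : {mpoly R[n]}) :
    odd k -> odd k' -> sos_power d k p -> sos_power d k' p' ->
  sos_power d (k + k' - 1) (p + p').
Proof.
case: k k' => [//|a] [//|b]; rewrite /= => a_even b_even.
move=> [[p_homog p_ge0] sos_p] [[p'_homog p'_ge0] sos_p'].
have s_homog : p + p' \is d.-homog by rewrite rpredD.
split; first by split=> // v; rewrite mevalD addr_ge0 ?p_ge0 ?p'_ge0.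
have sos_negbin c e (q : {mpoly R[n]}) : ~~ odd e -> q \is d.-homog ->
    sos_forms (e * d) (negbin_form c e (p + p') q).
  move=> e_even q_homog; rewrite -(even_halfK e_even).
  apply: sos_homogenize => //.
  - by rewrite size_negbin_poly.
  - by rewrite lead_negbin_poly negbin_lead_gt0.
  - by move=> x; apply: negbin_poly_ge0; rewrite odd_double.
rewrite addSn addnS subn1 /= exprD_negbin; apply: sos_formsD.
- by rewrite -addSn mulnDl; apply: sos_formsM => //; apply: sos_negbin.
- by rewrite -addnS addnC mulnDl; apply: sos_formsM => //; apply: sos_negbin.
Qed.

Lemma sos_powerZ (R : realType) (n d k : nat) (c : R) (p : {mpoly R[n]}) :
  0 <= c -> sos_power d k p -> sos_power d k (c *: p).
Proof.
move=> c_ge0 [[p_homog p_ge0] sos_p]; split; first split.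
- exact: dhomogZ.
- by move=> v; rewrite mevalZ mulr_ge0 ?p_ge0.
- by rewrite exprZn; apply: sos_formsZ; rewrite ?exprn_ge0.
Qed.

Theorem theorem44 (R : realType) (n d : nat) :
  (forall (k k' : nat) (p p' : {mpoly R[n]}),
     odd k -> odd k' ->
     @sos_power R n d k p -> @sos_power R n d k' p' ->
     @sos_power R n d (k + k' - 1)%N (p + p')) /\
  convex_cone (@sos_power_inf R n d).
Proof.
split; first exact: sos_power_add.
split; first split.
- exists 0; exists 1%N => //=; split; first split.
  + exact: dhomog0.
  + by move=> v; rewrite meval0.
  + exact: sos_forms0.
- by move=> c p c_ge0 [k k_odd sos_p]; exists k => //; apply: sos_powerZ.
move=> p p' t /set_mem[k k_odd sos_p] /set_mem[k' k'_odd sos_p'].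
apply/mem_set; exists (k + k' - 1)%N.
  by case: k k_odd {sos_p} => //= k; rewrite addSn subn1 /= oddD => /negbTE->.
apply: sos_power_add => //; apply: sos_powerZ => //.
- exact: interval_inference.ge0.
- by rewrite subr_ge0; apply: interval_inference.le1.
Qed.
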